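(* Let $N\ge2$ and let $f:[0,\infty)\times[0,\infty)\times\mathbb{R}\to\mathbb{R}$, $(t,r,u)\mapsto f(t,r,u)$, be such that $\partial_uf(t,r,u)$ is bounded uniformly in $t$ and $r$ and such that, for some $R_0>0$, $$f(t,r_1,u)\ge f(t,r_2,u)\quad\text{whenever } 0\le r_1\le R_0\le r_2\ \text{ or }\ R_0\le r_1\le r_2,\quad\text{for all } t>0,\ u\in\mathbb{R}.$$ Let $u\in C^{2,1}(\mathbb{R}^N\times(0,\infty))\cap C(\mathbb{R}^N\times[0,\infty))$ be a classical solution of $$u_t-\Delta u=f(t,|x|,u)\ \text{ in }\mathbb{R}^N\times(0,\infty),\qquad u(x,0)=u_0(x)\ \text{ for } x\in\mathbb{R}^N.$$ If 1. $u_0\ge0$, 2. $u_0$ has compact support, 3. $\|u(\cdot,t)\|_{L^\infty(\mathbb{R}^N)}\le C$ and $\|u(\cdot,t)\|_{L^q(\mathbb{R}^N)}\le C$ for some $C>0$, some $1\le q<\infty$, and all $t>0$, then $\lim_{|x|\to\infty}\sup_{t>0}|u(x,t)|=0$. *)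

(* Defs.v *)
From HB Require Import structures.
From mathcomp Require Import all_boot all_order all_algebra.
From mathcomp Require Import all_classical all_reals all_analysis.
Set Implicit Arguments.
Unset Strict Implicit.
Unset Printing Implicit Defensive.
Import Order.TTheory GRing.Theory Num.Theory.
Import numFieldNormedType.Exports.
Local Open Scope classical_set_scope.
Local Open Scope ring_scope.

(* The library norm on 'rV[R]_N is the sup norm, hence this separate
   Euclidean norm. *)
Definition enorm {R : realType} {N : nat} (x : 'rV[R]_N) : R :=
  Num.sqrt (\sum_(i < N) x 0 i ^+ 2).

(* Neighbourhoods of infinity: the filter of "|x| -> +oo". *)
Definition at_infinity (R : realType) (N : nat) : set_system 'rV[R]_N :=
  filter_from [set: R] (fun M => [set x | M < enorm x]).
Arguments at_infinity : clear implicits.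

Global Instance at_infinity_filter (R : realType) (N : nat) :
  Filter (at_infinity R N).
Proof.
apply: filter_from_filter; first by exists 0.
move=> M1 M2 _ _; exists (Num.max M1 M2) => // x /=.
by rewrite gt_max => /andP[].
Qed.

Definition basis_vec {R : realType} {N : nat} (i : 'I_N) : 'rV[R]_N :=
  delta_mx 0 i.

Section space_time.
Context {R : realType} {N : nat}.
Implicit Types (u : 'rV[R]_N -> R -> R) (x : 'rV[R]_N) (t : R).

Definition dx u (i : 'I_N) x t : R := 'D_(basis_vec i) (u ^~ t) x.
Definition dxx u (i j : 'I_N) x t : R := dx (dx u i) j x t.
Definition dt u x t : R := derive1 (u x) t.
Definition laplacian u x t : R := \sum_(i < N) dxx u i i x t.

Definition continuous_on_spacetime (T : set R) u : Prop :=
  {within [set p : 'rV[R]_N * R | T p.2], continuous (fun p => u p.1 p.2)}.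

(* C^{2,1}(R^N x T), for T open. *)
Definition C21 (T : set R) u : Prop :=
  [/\ continuous_on_spacetime T u,
      (forall x t, T t -> derivable (u x) t 1) /\
        continuous_on_spacetime T (dt u),
      (forall i x t, T t -> derivable (u ^~ t) x (basis_vec i)) /\
        (forall i, continuous_on_spacetime T (dx u i)) &
      (forall i j x t, T t -> derivable (dx u i ^~ t) x (basis_vec j)) /\
        (forall i j, continuous_on_spacetime T (dxx u i j))].

End space_time.

Definition tuple_cons {R : realType} {n : nat}
    (p : measurableTypeR R * n.-tuple (measurableTypeR R)) :
    n.+1.-tuple (measurableTypeR R) :=
  [tuple of p.1 :: p.2].

Lemma measurable_tuple_cons (R : realType) (n : nat) :
  measurable_fun [set: measurableTypeR R * n.-tuple (measurableTypeR R)]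
    (@tuple_cons R n).
Proof. exact: measurable_cons. Qed.

Lemma product_measure_sigma_finite d1 d2 (T1 : measurableType d1)
    (T2 : measurableType d2) (R : realType)
    (m1 : {sigma_finite_measure set T1 -> \bar R})
    (m2 : {sigma_finite_measure set T2 -> \bar R}) :
  sigma_finite setT (m1 \x m2)%E.
Proof.
have /sigma_finiteP[F [TF ndF Foo]] := sigma_finiteT m1.
have /sigma_finiteP[G [TG ndG Goo]] := sigma_finiteT m2.
exists (fun n => F n `*` G n).
  rewrite -setXTT TF TG predeqE => -[x y]; split.
    move=> [/= [n _ Fnx] [k _ Gky]]; exists (maxn n k) => //; split.
    - by move: x Fnx; exact/subsetPset/ndF/leq_maxl.
    - by move: y Gky; exact/subsetPset/ndG/leq_maxr.
  by move=> [n _ []/= ? ?]; split; exists n.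
move=> k; have [? ?] := Foo k; have [? ?] := Goo k.
split; first exact: measurableX.
by rewrite product_measure1E// lte_mul_pinfty// ge0_fin_numE.
Qed.

Section lebesgue_cons.
Context {R : realType} {n : nat}.
Variable mu : {sigma_finite_measure set (n.-tuple (measurableTypeR R)) -> \bar R}.
Local Open Scope ereal_scope.

Definition lebesgue_cons : set (n.+1.-tuple (measurableTypeR R)) -> \bar R :=
  pushforward (@lebesgue_measure R \x mu) (@tuple_cons R n).

Let nu0 : lebesgue_cons set0 = 0.
Proof. by rewrite /lebesgue_cons /pushforward preimage_set0 measure0. Qed.

Let nu_ge0 A : 0 <= lebesgue_cons A.
Proof. by rewrite /lebesgue_cons /pushforward; exact: measure_ge0. Qed.

Let nu_sigma_additive : semi_sigma_additive lebesgue_cons.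
Proof.
have mtc A : measurable A -> measurable (@tuple_cons R n @^-1` A).
  by move=> mA; rewrite -[X in measurable X]setTI; exact: measurable_tuple_cons.
move=> F mF tF mUF; rewrite /lebesgue_cons /pushforward preimage_bigcup.
apply: measure_semi_sigma_additive.
- by move=> i; exact: mtc.
- apply/trivIsetP => /= i j _ _ ij; rewrite -preimage_setI.
  by move/trivIsetP : tF => /(_ _ _ _ _ ij) ->//; rewrite preimage_set0.
- by rewrite -preimage_bigcup; exact: mtc.
Qed.

HB.instance Definition _ :=
  isMeasure.Build _ _ _ lebesgue_cons nu0 nu_ge0 nu_sigma_additive.

Let nu_sigma_finite : sigma_finite setT lebesgue_cons.
Proof.
have [F UF mF] := product_measure_sigma_finite (@lebesgue_measure R) mu.
pose g (v : n.+1.-tuple (measurableTypeR R)) := (thead v, [tuple of behead v]).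
have mg : measurable_fun setT g.
  apply: measurable_fun_pair; first exact: measurable_tnth.
  exact: measurable_behead.
have gK p : g (tuple_cons p) = p.
  by case: p => a v; congr pair; apply: val_inj.
exists (fun i => g @^-1` F i).
  by rewrite -preimage_bigcup -UF preimage_setT.
move=> i; have [mFi Foo] := mF i; split.
  by rewrite -[X in measurable X]setTI; exact: mg.
rewrite /lebesgue_cons /pushforward (_ : _ @^-1` _ = F i)//.
by apply/seteqP; split => p /=; rewrite gK.
Qed.

HB.instance Definition _ :=
  Measure_isSigmaFinite.Build _ _ _ lebesgue_cons nu_sigma_finite.

End lebesgue_cons.

(* Lebesgue measure on R^n as the n-fold product of the one on R. *)
Fixpoint lebesgue_tuple (R : realType) (n : nat) :
    {sigma_finite_measure set (n.-tuple (measurableTypeR R)) -> \bar R} :=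
  match n with
  | 0 => @dirac _ (0.-tuple (measurableTypeR R)) [tuple] R
  | m.+1 => lebesgue_cons (lebesgue_tuple R m)
  end.

Definition row_of_tuple {R : realType} {N : nat}
    (v : N.-tuple (measurableTypeR R)) : 'rV[R]_N :=
  \row_(i < N) tnth v i.

(* || g ||_{L^q(R^N)}. The product sigma-algebra is carried by N-tuples and the
   topology by row vectors. *)
Definition Lq_norm {R : realType} {N : nat} (q : \bar R) (g : 'rV[R]_N -> R) :
    \bar R :=
  Lnorm (lebesgue_tuple R N) q (fun v => (g (row_of_tuple v))%:E).

(* "The derivative of f(t,r,u) in u is bounded uniformly in t, r": it exists
   everywhere, and for u in a bounded set it has a bound independent of
   t, r >= 0. *)
Definition du_bounded_uniformly {R : realType} (f : R -> R -> R -> R) : Prop :=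
  (forall t r v, 0 <= t -> 0 <= r -> derivable (f t r) v 1) /\
  (forall M : R, exists L : R, forall t r v, 0 <= t -> 0 <= r -> `|v| <= M ->
     `|derive1 (f t r) v| <= L).

Definition compact_support {R : realType} {N : nat} (g : 'rV[R]_N -> R) : Prop :=
  compact (closure [set x | g x != 0]).

(* Main.v *)
Require Import Defs.
From HB Require Import structures.
From mathcomp Require Import all_boot all_order all_algebra.
From mathcomp Require Import all_classical all_reals all_analysis.
From mathcomp Require Import ess_sup_inf ring lra.
Set Implicit Arguments.
Unset Strict Implicit.
Unset Printing Implicit Defensive.
Import Order.TTheory GRing.Theory Num.Theory.
Import numFieldNormedType.Exports.
Local Open Scope classical_set_scope.
Local Open Scope ring_scope.

(* For a unit vector e and lam large, the reflection y of x in the hyperplane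
   <z, e> = lam satisfies |y| <= |x| whenever <x, e> >= lam. As f decreases in r,
   the difference w(x,t) = u(x,t) - u(y,t) is a subsolution of a linear parabolic
   equation with bounded zeroth-order coefficient on that half-space; it vanishes
   on the boundary and is nonpositive at t = 0, because the half-space misses the
   support of u0. By the maximum principle w <= 0. Any two points with
   |x| >= |y| + 2A are exchanged by such a reflection, so u(x,t) <= u(y,t) for all
   t > 0. Hence if u(x,t) > eps with |x| large, then u(.,t) > eps on a large cube
   around 0, and if u(x,t) < -eps, then u(.,t) < -eps on arbitrarily large cubes
   far away; both contradict the L^q bound. *)

(** * Directional derivatives and second-order conditions at a maximum *)

(** Both difference quotients are the same function of [h], so the derivative along [v] passes to
    the parameter of the line. *)
Lemma is_derive_line (R : realType) (V : normedModType R) (g : V -> R)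
    (y v : V) (s dg : R) :
  is_derive (s *: v + y) v g dg -> is_derive s 1 (fun r => g (r *: v + y)) dg.
Proof.
have E : (fun h : R => h^-1 *: (((fun r => g (r *: v + y)) \o shift s) (h *: 1)
      - g (s *: v + y)))
    = (fun h => h^-1 *: ((g \o shift (s *: v + y)) (h *: v) - g (s *: v + y))).
  apply/funext => h /=; congr (_ *: (g _ - _)).
  by rewrite -[h *: 1]/(h * 1) mulr1 scalerDl addrA.
by move=> [g1 g2]; split; rewrite /derivable /derive E.
Qed.

(** Mean value theorem with an increment of either sign, possibly zero, as it occurs for [h * c] in
    [is_derive_addv]. *)
Lemma MVT_line (R : realType) (p dp : R -> R) (a : R) :
  (forall s : R, is_derive s 1 p (dp s)) ->
  exists2 s, `|s| <= `|a| & p a - p 0 = a * dp s.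
Proof.
move=> hp.
have cp : continuous p.
  move=> s; apply: differentiable_continuous.
  by apply/derivable1_diffP; case: (hp s).
have [a0|a0|<-] := ltgtP 0 a.
- have [|x /itvP xi E] := @MVT _ p dp _ _ a0 (fun s _ => hp s).
    exact: continuous_subspaceT.
  exists x; first by rewrite !gtr0_norm ?xi.
  by rewrite E subr0 mulrC.
- have [|x /itvP xi E] := @MVT _ p dp _ _ a0 (fun s _ => hp s).
    exact: continuous_subspaceT.
  exists x; first by rewrite !ltr0_norm ?lerN2 ?xi.
  by rewrite -opprB E sub0r mulrN opprK mulrC.
- by exists 0; rewrite // subrr mul0r.
Qed.

(** Since [g1 0 = 0], a positive [g2] would make [g1] positive just to the right of 0, and the mean
    value theorem would give [g s > g 0] there. *)
Lemma derive2_at_max (R : realType) (g g1 : R -> R) (g2 d : R) :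
  0 < d -> (forall s : R, is_derive s 1 g (g1 s)) ->
  is_derive (0 : R) 1 g1 g2 ->
  (forall s, `|s| < d -> g s <= g 0) -> g2 <= 0.
Proof.
move=> d0 hg hg1 gmax.
have g10 : g1 0 = 0.
  have : is_derive (0 : R) 1 g 0.
    apply: (@derive1_at_max _ g (- d) d 0).
    - by rewrite ge0_cp ?ltW.
    - by move=> x _; case: (hg x).
    - by rewrite in_itv /= oppr_lt0 d0.
    - by move=> t; rewrite in_itv /= -ltr_norml; exact: gmax.
  by move=> [_ E0]; have [_ E1] := hg 0; rewrite -E1.
rewrite leNgt; apply/negP => g20.
have [dg1 vg1] := hg1.
have /cvgrPdist_lt /(_ _ g20) : h^-1 *: (g1 (h *: 1 + 0) - g1 0) @[h --> 0^'] --> g2.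
  by rewrite -vg1; exact: dg1.
rewrite g10 => -[e /= e0 He].
pose s := Num.min (e / 2) (d / 2).
have s0 : 0 < s by rewrite lt_min !divr_gt0.
have se : s <= e / 2 by rewrite ge_min lexx.
have sd : s <= d / 2 by rewrite ge_min lexx orbT.
have [|x /itvP xi E] := @MVT _ g g1 _ _ s0 (fun s _ => hg s).
  apply: continuous_subspaceT => r; apply: differentiable_continuous.
  by apply/derivable1_diffP; case: (hg r).
have x0 : 0 < x by rewrite xi.
have xs : x < s by rewrite xi.
have : 0 < g1 x.
  have /= := He x; rewrite sub0r normrN gtr0_norm // gt_eqF // => /(_ _ isT).
  rewrite subr0 addr0 -[x *: 1]/(x * 1) mulr1 -[_ *: _]/(_ * _) => H.
  have : `|g2 - x^-1 * g1 x| < g2 by apply: H; lra.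
  rewrite ltr_norml => /andP[_]; rewrite ltrBlDr ltrDl.
  by rewrite pmulr_rgt0 // invr_gt0.
have := gmax s; rewrite gtr0_norm // => /(_ _).
rewrite -subr_le0 E subr0 => H g1x.
have : g1 x * s <= 0 by apply: H; lra.
by rewrite leNgt mulr_gt0.
Qed.

(** Move first by [h *: b], then by [(h * c) *: e]. The mean value theorem turns the second
    increment into a value of the derivative along [e] near [y], and continuity at [y] gives the
    limit. *)
Lemma is_derive_addv (R : realType) (V : normedModType R) (g : V -> R)
    (y b e : V) (c db : R) :
  is_derive y b g db -> (forall x, derivable g x e) ->
  {for y, continuous (fun x => 'D_e g x)} ->
  is_derive y (b + c *: e) g (db + c * 'D_e g y).
Proof.
move=> [gb gbE] ge cge.
suff H : h^-1 *: ((g \o shift y) (h *: (b + c *: e)) - g y) @[h --> 0^'] -->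
    db + c * 'D_e g y.
  by split; [apply/cvg_ex; eexists; exact: H | exact/cvg_lim].
have -> : (fun h => h^-1 *: ((g \o shift y) (h *: (b + c *: e)) - g y)) =
    (fun h => h^-1 *: ((g \o shift y) (h *: b) - g y)) \+
    (fun h => h^-1 *: (g ((h * c) *: e + (h *: b + y)) - g (h *: b + y))).
  apply/funext => h /=; rewrite -scalerDr; congr (_ *: _).
  rewrite [RHS]addrC addrA subrK; congr (g _ - _).
  by rewrite scalerDr scalerA -addrA addrCA.
apply: cvgD; first by rewrite -gbE; exact: gb.
apply/cvgrPdist_lt => eps eps0.
have c1 : 0 < `|c| + 1 by rewrite ltr_wpDl.
have /cvgrPdist_lt /(_ (eps / (`|c| + 1))) := cge.
rewrite divr_gt0 // => /(_ isT) /nbhs_ballP[d /= d0 Hd].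
(* The intermediate point [s *: e + (h *: b + y)] is within |h| times [K] of [y]; the summand 1
   makes [K] positive. *)
pose K := `|b| + `|c| * `|e| + 1.
have K0 : 0 < K by rewrite ltr_wpDl // addr_ge0 // mulr_ge0.
exists (d / K) => /=; first exact: divr_gt0.
move=> h /=; rewrite sub0r normrN ltr_pdivlMr // => hd h0.
have [s sh] := @MVT_line _ (fun r => g (r *: e + (h *: b + y)))
  (fun r => 'D_e g (r *: e + (h *: b + y))) (h * c)
  (fun r => is_derive_line (derivableP (ge _))); rewrite scale0r add0r => ->.
rewrite -[_ *: _]/(_ * _) mulrA mulrA mulVf // mul1r -mulrBr normrM.
apply: (@le_lt_trans _ _ (`|c| * (eps / (`|c| + 1)))); last first.
  by rewrite mulrCA gtr_pMr // ltr_pdivrMr // mul1r ltrDl.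
apply: ler_wpM2l => //; apply/ltW/Hd.
have E : y - (s *: e + (h *: b + y)) = - (s *: e + h *: b).
  by rewrite addrA opprD addrCA subrr addr0.
rewrite -ball_normE /= E normrN; apply: le_lt_trans hd.
apply: (le_trans (ler_normD _ _)); rewrite !normrZ.
apply: (@le_trans _ _ (`|h * c| * `|e| + `|h| * `|b|)).
  by rewrite lerD2r ler_wpM2r.
by rewrite normrM /K !mulrDr mulr1 mulrA addrC lerDl.
Qed.

(** The coordinate directions are added one at a time, by induction on the list of indices. *)
Lemma is_derive_rV (R : realType) (N : nat) (g : 'rV[R]_N -> R)
    (y v : 'rV[R]_N) :
  (forall i x, derivable g x (basis_vec i)) ->
  (forall i, continuous (fun x => 'D_(basis_vec i) g x)) ->
  is_derive y v g (\sum_(i < N) v 0 i * 'D_(basis_vec i) g y).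
Proof.
move=> dg cg; rewrite {1}(row_sum_delta v).
elim: (index_enum _) => [|i r IH]; first by rewrite !big_nil; exact: is_derive0.
rewrite !big_cons addrC [X in is_derive _ _ _ X]addrC.
apply: is_derive_addv => //; [exact: (dg i) | exact: (cg i y)].
Qed.

Lemma is_derive2_line (R : realType) (N : nat) (g : 'rV[R]_N -> R)
    (y v : 'rV[R]_N) :
  (forall i x, derivable g x (basis_vec i)) ->
  (forall i, continuous (fun x => 'D_(basis_vec i) g x)) ->
  (forall i j x, derivable (fun x => 'D_(basis_vec i) g x) x (basis_vec j)) ->
  (forall i j, continuous
     (fun x => 'D_(basis_vec j) (fun x => 'D_(basis_vec i) g x) x)) ->
  is_derive (0 : R) 1
    (fun s => \sum_(i < N) v 0 i * 'D_(basis_vec i) g (s *: v + y))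
    (\sum_(i < N) \sum_(j < N) v 0 i * v 0 j *
       'D_(basis_vec j) (fun x => 'D_(basis_vec i) g x) y).
Proof.
move=> dg cg ddg cdg.
have -> : (fun s => \sum_(i < N) v 0 i * 'D_(basis_vec i) g (s *: v + y)) =
    \sum_(i < N) (v 0 i *: (fun s => 'D_(basis_vec i) g (s *: v + y))).
  by apply/funext => s; rewrite fct_sumE.
apply: is_derive_sum => i.
under eq_bigr do rewrite -mulrA; rewrite -mulr_sumr.
apply: is_deriveZ.
apply: (@is_derive_line _ _ (fun x => 'D_(basis_vec i) g x)).
by rewrite scale0r add0r; exact: is_derive_rV.
Qed.

(** * Reflections *)

Definition dotv {R : realType} {N : nat} (x y : 'rV[R]_N) : R :=
  \sum_(i < N) x 0 i * y 0 i.

Definition refl {R : realType} {N : nat} (e : 'rV[R]_N) (lam : R)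
    (x : 'rV[R]_N) : 'rV[R]_N :=
  x - (2 * (dotv x e - lam)) *: e.

Section dotv_theory.
Context {R : realType} {N : nat}.
Implicit Types x y z e : 'rV[R]_N.

Lemma dotvC x y : dotv x y = dotv y x.
Proof. by apply: eq_bigr => i _; rewrite mulrC. Qed.

Lemma dotvDl x y z : dotv (x + y) z = dotv x z + dotv y z.
Proof. by rewrite -big_split; apply: eq_bigr => i _; rewrite mxE mulrDl. Qed.

Lemma dotvZl a x y : dotv (a *: x) y = a * dotv x y.
Proof. by rewrite mulr_sumr; apply: eq_bigr => i _; rewrite mxE mulrA. Qed.

Lemma dotvBl x y z : dotv (x - y) z = dotv x z - dotv y z.
Proof. by rewrite dotvDl -scaleN1r dotvZl mulN1r. Qed.

Lemma dotvBr x y z : dotv z (x - y) = dotv z x - dotv z y.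
Proof. by rewrite dotvC dotvBl !(dotvC z). Qed.

Lemma dotvZr a x y : dotv x (a *: y) = a * dotv x y.
Proof. by rewrite dotvC dotvZl dotvC. Qed.

Lemma dotv_ge0 x : 0 <= dotv x x.
Proof. by apply: sumr_ge0 => i _; rewrite -expr2 sqr_ge0. Qed.

Lemma dotv_eq0 x : dotv x x = 0 -> x = 0.
Proof.
move=> /eqP; rewrite psumr_eq0 => [|i _]; last by rewrite -expr2 sqr_ge0.
move=> /allP H; apply/rowP => i; rewrite mxE; apply/eqP.
by have := H i; rewrite mem_index_enum mulf_eq0 orbb => /(_ isT).
Qed.

Lemma dotv_basis i x : dotv (basis_vec i) x = x 0 i.
Proof.
rewrite /dotv (bigD1 i) //= big1 => [|j /negPf ji].
  by rewrite mxE !eqxx mul1r addr0.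
by rewrite mxE ji andbF mul0r.
Qed.

Lemma enorm_ge0 x : 0 <= enorm x.
Proof. exact: sqrtr_ge0. Qed.

Lemma enorm_sqr x : enorm x ^+ 2 = dotv x x.
Proof.
rewrite sqr_sqrtr; first by apply: eq_bigr => i _; rewrite expr2.
by apply: sumr_ge0 => i _; rewrite sqr_ge0.
Qed.

(** The vector [x] minus its projection on [e] has nonnegative squared length, namely |x|^2 -
    (x.e)^2. *)
Lemma dotv_unit_le e x : dotv e e = 1 -> dotv x e <= enorm x.
Proof.
move=> e1; have := dotv_ge0 (x - dotv x e *: e).
rewrite dotvBl !dotvBr !dotvZl !dotvZr e1 (dotvC e x) -enorm_sqr.
by have := enorm_ge0 x; nra.
Qed.

Lemma cauchy_schwarz x y : dotv x y <= enorm x * enorm y.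
Proof.
have [y0|y0] := eqVneq (enorm y) 0.
  have /dotv_eq0 -> : dotv y y = 0 by rewrite -enorm_sqr y0 expr0n.
  rewrite dotvC -[X in dotv X _](scale0r 0) dotvZl mul0r.
  by rewrite mulr_ge0 // enorm_ge0.
have /(dotv_unit_le x) : dotv ((enorm y)^-1 *: y) ((enorm y)^-1 *: y) = 1.
  by rewrite dotvZl dotvZr -enorm_sqr expr2 mulKf // mulVf.
by rewrite dotvZr mulrC ler_pdivrMr // lt_neqAle eq_sym y0 enorm_ge0.
Qed.

Lemma enormB_le x y : enorm (x - y) <= enorm x + enorm y.
Proof.
rewrite -ler_sqr ?nnegrE ?addr_ge0 ?enorm_ge0 //.
rewrite enorm_sqr dotvBl !dotvBr (dotvC y x) -!enorm_sqr.
have := cauchy_schwarz (- x) y; rewrite -scaleN1r dotvZl.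
have -> : enorm (-1 *: x) = enorm x.
  rewrite /enorm; congr Num.sqrt; apply: eq_bigr => i _.
  by rewrite mxE mulN1r sqrrN.
by nra.
Qed.

Lemma coord_le_enorm x i : `|x 0 i| <= enorm x.
Proof.
rewrite -sqrtr_sqr ler_wsqrtr // (bigD1 i) //= lerDl.
by apply: sumr_ge0 => j _; rewrite sqr_ge0.
Qed.

Lemma enorm_le_sum x (a : R) : 0 <= a -> (forall i, `|x 0 i| <= a) ->
  enorm x <= N%:R * a.
Proof.
move=> a0 xa; rewrite -[leRHS]ger0_norm ?mulr_ge0 // -sqrtr_sqr ler_wsqrtr //.
apply: (@le_trans _ _ (\sum_(i < N) a ^+ 2)).
  apply: ler_sum => i _.
  by rewrite -[x 0 i ^+ 2]real_normK ?num_real // lerXn2r ?nnegrE.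
rewrite sumr_const card_ord -[leLHS]mulr_natl exprMn ler_wpM2r ?sqr_ge0 //.
by rewrite -natrX ler_nat; case: (N) => // n; rewrite expnS leq_pmulr // expn_gt0.
Qed.

Lemma reflE e lam x : dotv x e = lam -> refl e lam x = x.
Proof. by move=> xe; rewrite /refl xe subrr mulr0 scale0r subr0. Qed.

Lemma refl_line e lam b x s :
  refl e lam (s *: b + x) = s *: (b - (2 * dotv b e) *: e) + refl e lam x.
Proof.
rewrite /refl dotvDl dotvZl; apply/rowP => i; rewrite !mxE; ring.
Qed.

(** The squared norms of [x] and its image differ by exactly [4 * lam * (dotv x e - lam)]. *)
Lemma enorm_refl_le e lam x : dotv e e = 1 -> 0 <= lam -> lam <= dotv x e ->
  enorm (refl e lam x) <= enorm x.
Proof.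
move=> e1 l0 xl; rewrite -ler_sqr ?nnegrE ?enorm_ge0 // !enorm_sqr.
rewrite /refl dotvBl !dotvBr !dotvZl !dotvZr e1 (dotvC e x); nra.
Qed.

(** The mirror is the perpendicular bisector of [x] and [y]. Its level is (|x| - |y|)(|x| + |y|) /
    (2d): the first factor is at least 2A, and the second is at least d by the triangle
    inequality. *)
Lemma refl_bisector (A : R) x y : 0 < A -> enorm y + 2 * A <= enorm x ->
  exists e lam, [/\ dotv e e = 1, A <= lam, lam <= dotv x e & refl e lam x = y].
Proof.
move=> A0 yx; set d := enorm (x - y).
have y0 := enorm_ge0 y; have d0 : 0 < d.
  rewrite lt_neqAle enorm_ge0 andbT eq_sym; apply/eqP => d0.
  have /dotv_eq0 /subr0_eq E : dotv (x - y) (x - y) = 0.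
    by rewrite -enorm_sqr -/d d0 expr0n.
  by move: yx; rewrite E; lra.
have dn := lt0r_neq0 d0.
have dd : dotv x x - 2 * dotv x y + dotv y y = d ^+ 2.
  by rewrite enorm_sqr dotvBl !dotvBr (dotvC y x); ring.
have dxy : d <= enorm x + enorm y := enormB_le x y.
pose e := d^-1 *: (x - y); pose lam := (dotv x x - dotv y y) / 2 / d.
have xe : dotv x e - lam = d / 2.
  rewrite /e /lam dotvZr dotvBr.
  have -> : dotv x y = (dotv x x + dotv y y - d ^+ 2) / 2 by lra.
  by field.
exists e, lam; split.
- by rewrite /e dotvZl dotvZr -enorm_sqr -/d expr2 mulKf // mulVf.
- rewrite /lam ler_pdivlMr // -!enorm_sqr; nra.
- by rewrite -subr_ge0 xe; lra.
- rewrite /refl xe mulrCA divff ?pnatr_eq0 // mulr1 /e scalerA divff // scale1r.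
  by rewrite opprB addrC subrK.
Qed.

(** Invariance of the trace under an orthogonal change of basis: summing over [i] first produces the
    entries of [P^T *m P]. *)
Lemma sum_orthogonal (P : 'M[R]_N) (H : 'I_N -> 'I_N -> R) : P^T *m P = 1%:M ->
  \sum_i \sum_k \sum_l P i k * P i l * H k l = \sum_k H k k.
Proof.
move=> PP; rewrite exchange_big /=; apply: eq_bigr => k _.
rewrite exchange_big /= (bigD1 k) //= [X in _ + X]big1 => [|l lk].
  rewrite addr0 -mulr_suml; have /matrixP /(_ k k) := PP.
  rewrite !mxE eqxx => PPk; rewrite -[RHS]mul1r; congr (_ * _); rewrite -[RHS]PPk.
  by apply: eq_bigr => i _; rewrite mxE.
rewrite -mulr_suml; have /matrixP /(_ k l) := PP.
rewrite !mxE eq_sym (negPf lk) => PPk; rewrite -[RHS](mul0r (H k l)); congr (_ * _).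
by rewrite -[RHS]PPk; apply: eq_bigr => i _; rewrite mxE.
Qed.

(** As [e] is a row, [e^T *m e] is the projection on its span; [P] is symmetric and squares to the
    identity. *)
Lemma householder_orthogonal e : dotv e e = 1 ->
  let P := 1%:M - 2 *: (e^T *m e) in P^T *m P = 1%:M.
Proof.
move=> e1 P; have ee : e *m e^T = 1%:M.
  apply/matrixP => i j; rewrite !ord1 !mxE eqxx -e1.
  by apply: eq_bigr => k _; rewrite mxE.
have PT : P^T = P by rewrite /P linearB linearZ /= trmx1 trmx_mul trmxK.
rewrite PT /P mulmxBl mul1mx mulmxBr mulmx1 -scalemxAl -scalemxAr.
rewrite -mulmxA (mulmxA e) ee mul1mx scalerA.
by apply/matrixP => i j; rewrite !mxE; ring.
Qed.

End dotv_theory.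

(** One-sided version, because the maximum in time may sit at the final time. A negative derivative
    would give larger values just before [b]. *)
Lemma derive_ge0_left_max (R : realType) (p : R -> R) (a b dp : R) :
  a < b -> is_derive b 1 p dp -> (forall s, a < s -> s <= b -> p s <= p b) ->
  0 <= dp.
Proof.
move=> ab [gp <-] pmax; rewrite leNgt; apply/negP => g20.
have /cvgrPdist_lt /(_ (- 'D_1 p b)) := gp.
rewrite oppr_gt0 => /(_ g20) [e /= e0 He].
pose s := Num.min (e / 2) ((b - a) / 2).
have s0 : 0 < s by rewrite lt_min !divr_gt0 // subr_gt0.
have se : s <= e / 2 by rewrite ge_min lexx.
have sd : s <= (b - a) / 2 by rewrite ge_min lexx orbT.
have /= := He (- s); rewrite sub0r opprK gtr0_norm // oppr_eq0 gt_eqF //.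
have se' : s < e by lra.
move=> /(_ se' isT); rewrite -[- s *: 1]/(- s * 1) mulr1 -[_ *: _]/(_ * _).
rewrite ltr_norml => /andP[H _]; have := pmax (- s + b).
have -> : a < - s + b by lra.
have -> : - s + b <= b by lra.
move=> /(_ isT isT) pb; move: H; apply/negP; rewrite -leNgt opprK gerBl.
by rewrite invrN mulNr oppr_ge0 pmulr_rle0 ?invr_gt0 // subr_le0.
Qed.

(* The reflection enters only through the orthogonality of its linear part, so
   the Hessian need not be known to be symmetric. *)
Lemma laplacian_refl_at_max (R : realType) (N : nat) (v : 'rV[R]_N -> R)
    (e x0 : 'rV[R]_N) (lam a eps d : R) :
  (forall i x, derivable v x (basis_vec i)) ->
  (forall i, continuous (fun x => 'D_(basis_vec i) v x)) ->
  (forall i j x, derivable (fun x => 'D_(basis_vec i) v x) x (basis_vec j)) ->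
  (forall i j, continuous
     (fun x => 'D_(basis_vec j) (fun x => 'D_(basis_vec i) v x) x)) ->
  dotv e e = 1 -> 0 < d ->
  let h x := a * (v x - v (refl e lam x)) - eps * dotv x x in
  let lap x := \sum_(i < N) 'D_(basis_vec i) (fun x => 'D_(basis_vec i) v x) x in
  (forall i s, `|s| < d -> h (s *: basis_vec i + x0) <= h x0) ->
  a * (lap x0 - lap (refl e lam x0)) <= N%:R * (2 * eps).
Proof.
move=> dv cv ddv cdv e1 d0 h lap hmax.
pose H x k l := 'D_(basis_vec l) (fun x => 'D_(basis_vec k) v x) x.
pose P : 'M[R]_N := 1%:M - 2 *: (e^T *m e).
have lap1 : lap x0 = \sum_i \sum_k \sum_l
    (basis_vec i : 'rV[R]_N) 0 k * (basis_vec i : 'rV[R]_N) 0 l * H x0 k l.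
  rewrite /lap -(@sum_orthogonal _ _ 1%:M (H x0)) ?trmx1 ?mul1mx //.
  apply: eq_bigr => i _; apply: eq_bigr => k _; apply: eq_bigr => l _.
  by rewrite !mxE !eqxx /= (eq_sym i k) (eq_sym i l).
(* The image of the [i]-th basis vector under the linear part of the reflection, equal to row [i] of
   [P]. *)
pose b i : 'rV[R]_N := basis_vec i - (2 * dotv (basis_vec i) e) *: e.
have lap2 : lap (refl e lam x0) =
    \sum_i \sum_k \sum_l b i 0 k * b i 0 l * H (refl e lam x0) k l.
  rewrite /lap -(sum_orthogonal (H (refl e lam x0)) (householder_orthogonal e1)).
  apply: eq_bigr => i _; apply: eq_bigr => k _; apply: eq_bigr => l _.
  congr (_ * _ * _); rewrite /b dotv_basis !mxE !big_ord_recl !big_ord0 !mxE eqxx.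
    by rewrite (eq_sym i k) /=; ring.
  by rewrite (eq_sym i l) /=; ring.
rewrite lap1 lap2 -sumrB mulr_sumr.
have -> : N%:R * (2 * eps) = \sum_(i < N) 2 * eps.
  by rewrite sumr_const card_ord mulr_natl.
(* For each [i], what remains is nonpositivity of the second derivative of [h] along the [i]-th axis
   at its maximum [x0]. *)
apply: ler_sum => i _; rewrite -subr_le0.
pose D (w y : 'rV[R]_N) (s : R) :=
  \sum_(k < N) w 0 k * 'D_(basis_vec k) v (s *: w + y).
apply: (@derive2_at_max _ (fun s => h (s *: basis_vec i + x0))
  (fun s => a * (D (basis_vec i) x0 s - D (b i) (refl e lam x0) s)
     - eps * (2 * x0 0 i + 2 * s)) _ _ d0).
- move=> s.
  have -> : (fun s => h (s *: basis_vec i + x0)) =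
      a *: ((fun s => v (s *: basis_vec i + x0)) -
            (fun s => v (s *: b i + refl e lam x0))) -
      eps *: ((2 * x0 0 i) *: (@id R) + (@id R) ^+ 2 + cst (dotv x0 x0)).
    apply/funext => r; rewrite /h refl_line -/(b i) dotvDl !(dotvC _ (_ + x0)).
    rewrite !dotvDl !dotvZl !dotvZr dotv_basis (dotvC x0) dotv_basis.
    have -> : forall (p1 p2 q : R -> R) (c : R),
        (a *: (p1 - p2) - eps *: (q + cst c)) r =
        a * (p1 r - p2 r) - eps * (q r + c) by [].
    rewrite -[(_ *: id + _) r]/((2 * x0 0 i) * r + r ^+ 2) mxE !eqxx /=; ring.
  apply: is_deriveB; apply: is_deriveZ.
    by apply: is_deriveB; apply: is_derive_line; exact: is_derive_rV.
  apply: is_derive_eq; rewrite addr0 -![_%:A]/(_ * 1) expr1; ring.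
- have -> : (fun s => a * (D (basis_vec i) x0 s - D (b i) (refl e lam x0) s) -
        eps * (2 * x0 0 i + 2 * s)) =
      a *: (D (basis_vec i) x0 - D (b i) (refl e lam x0)) -
      eps *: (2 *: (@id R) + cst (2 * x0 0 i)).
    by apply/funext => r; rewrite [2 * _ + _]addrC.
  rewrite [2 * eps]mulrC; apply: is_deriveB; apply: is_deriveZ.
    by apply: is_deriveB; exact: is_derive2_line.
  by apply: is_derive_eq; rewrite addr0 -![_%:A]/(_ * 1) mulr1.
- by move=> s sd; rewrite scale0r add0r; exact: hmax.
Qed.

(** * The maximum principle on a half-space *)

Lemma within_continuous_comp (X Y Z : topologicalType) (A : set X) (B : set Y)
    (f : X -> Y) (g : Y -> Z) :
  continuous f -> (forall x, A x -> B (f x)) -> {within B, continuous g} ->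
  {within A, continuous (g \o f)}.
Proof.
move=> cf AB /subspace_continuousP cg; apply/subspace_continuousP => x Ax.
apply: (@cvg_comp _ _ _ f g _ (within B (nbhs (f x)))); last exact: cg _ (AB _ Ax).
move=> U /= nU; apply: (@filterS _ (nbhs x) _ _ _ _ (cf x _ nU)).
by move=> y /= BU Ay; apply: BU; exact: AB.
Qed.

(** * Continuity on time slices and compactness of slabs *)

Section continuity.
Context {R : realType} {N : nat}.
Implicit Types (u : 'rV[R]_N -> R -> R) (e : 'rV[R]_N).

Lemma continuous_slice (T : set R) u t :
  continuous_on_spacetime T u -> T t -> continuous (u ^~ t).
Proof.
move=> cu Tt; apply/continuous_subspace_setT.
apply: (@within_continuous_comp _ _ _ setT [set p : 'rV[R]_N * R | T p.2]
  (fun x => (x, t)) (fun p => u p.1 p.2)) => //.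
move=> x; apply: (@cvg_pair _ _ _ (nbhs x) (nbhs x) (nbhs t)).
  exact: cvg_id.
exact: cvg_cst.
Qed.

Lemma cvg_sum_ord (T : topologicalType) (f : 'I_N -> T -> R) (x : T) :
  (forall i, {for x, continuous (f i)}) ->
  {for x, continuous (fun y => \sum_(i < N) f i y)}.
Proof.
move=> cf.
exact: (@cvg_big R 'I_N +%R 0 xpredT (@add_continuous _) _ (nbhs x)
  (index_enum _) f (f ^~ x) (nbhs_filter x) (fun i _ => cf i)).
Qed.

Lemma dotv_continuous (e : 'rV[R]_N) : continuous (fun x : 'rV[R]_N => dotv x e).
Proof.
move=> x; apply: cvg_sum_ord => i.
apply: (@continuousM _ _ (fun y : 'rV[R]_N => y 0 i) (fun=> e 0 i)).
  exact: coord_continuous.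
exact: cst_continuous.
Qed.

Lemma dotv_sqr_continuous : continuous (fun x : 'rV[R]_N => dotv x x).
Proof.
move=> x; apply: cvg_sum_ord => i.
apply: (@continuousM _ _ (fun y : 'rV[R]_N => y 0 i) (fun y => y 0 i));
  exact: coord_continuous.
Qed.

Lemma refl_continuous e lam : continuous (refl e lam).
Proof.
move=> x; apply: (@continuousB _ _ _ id
  (fun x => (2 * (dotv x e - lam)) *: e)); first exact: cvg_id.
apply: (@cvgZr_tmp _ _ _ (nbhs x) _ (fun x => 2 * (dotv x e - lam))).
apply: cvgM; first exact: cst_continuous.
by apply: cvgB; [exact: dotv_continuous | exact: cst_continuous].
Qed.

Lemma normr_le_enorm (x : 'rV[R]_N) : `|x| <= enorm x.
Proof.
rewrite [leLHS]/Num.norm /= mx_normrE; apply/bigmax_leP; split; first exact: enorm_ge0.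
by move=> [i j] _ /=; rewrite ord1 coord_le_enorm.
Qed.

Lemma coord_le_normr (x : 'rV[R]_N) i : `|x 0 i| <= `|x|.
Proof.
by rewrite [leRHS]/Num.norm /= mx_normrE; apply/bigmax_geP; right; exists (0, i).
Qed.

Lemma compact_slab e (lam rho t : R) :
  compact ([set x : 'rV[R]_N | lam <= dotv x e /\ `|x| <= rho] `*` `[0, t]%classic).
Proof.
apply: compact_setX; last exact: segment_compact.
apply: bounded_closed_compact.
  exists rho; split; first exact: num_real.
  by move=> M rM x [_ /le_trans]; apply; exact: ltW.
apply: closedI.
  rewrite -[X in closed X]/((fun x => dotv x e) @^-1` [set y | lam <= y]).
  by apply: preimage_closed; [move=> ? _; exact: dotv_continuous | exact: closed_ge].
rewrite -[X in closed X]/((fun x : 'rV[R]_N => `|x|) @^-1` [set y | y <= rho]).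
by apply: preimage_closed; [move=> ? _; exact: norm_continuous | exact: closed_le].
Qed.

End continuity.

(** * Scalar estimates for the maximum principle *)

Lemma is_derive_expRM (R : realType) (k : R) (g : R -> R) (t dg : R) :
  is_derive t 1 g dg ->
  is_derive t 1 (fun s => expR (k * s) * g s) (expR (k * t) * (dg + k * g t)).
Proof.
move=> hg.
have he : is_derive t 1 (fun s => expR (k * s)) (expR (k * t) * k).
  apply: is_derive1_comp.
  by apply: is_derive_eq; rewrite -[_ *: _]/(k * 1) mulr1.
apply: (is_derive_eq (is_deriveM he hg)).
by rewrite /GRing.scale /=; ring.
Qed.

(** The mean value point lies between [b] and [a], hence in [-C, C], where the derivative is
    bounded. *)
Lemma derive_le_lipschitz (R : realType) (g : R -> R) (C L a b : R) :
  (forall v : R, derivable g v 1) -> (forall v, `|v| <= C -> `|derive1 g v| <= L) ->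
  `|a| <= C -> `|b| <= C -> b <= a -> g a - g b <= L * (a - b).
Proof.
move=> dg gL aC bC; rewrite le_eqVlt => /predU1P[->|ba].
  by rewrite !subrr mulr0.
have [| |x /itvP xi ->] := @MVT _ g (derive1 g) _ _ ba.
- by move=> x _; rewrite derive1E; exact: derivableP.
- apply: continuous_subspaceT => x; apply: differentiable_continuous.
  exact/derivable1_diffP.
rewrite ler_wpM2r ?subr_ge0 ?(ltW ba) //; apply: le_trans (ler_norm _) (gL _ _).
move: aC bC; rewrite !ler_norml => /andP[_ aC] /andP[bC _].
have := xi; have : b < x by rewrite xi.
have : x < a by rewrite xi.
by move=> *; apply/andP; split; lra.
Qed.

(** Subtracting the space condition from the time condition cancels the [eps] terms and leaves
    [(L + 1) * w <= L * w]. *)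
Lemma strict_max_contradiction (R : realFieldType)
    (E dx dy lx ly n eps L w : R) :
  0 < E -> 0 < w -> 0 <= E * (dx - dy - (L + 1) * w) - eps * (2 * n) ->
  E * (lx - ly) <= n * (2 * eps) -> dx - lx - (dy - ly) <= L * w -> False.
Proof.
move=> E0 w0 H1 H2 H3; have : 0 <= E * (dx - lx - (dy - ly) - (L + 1) * w) by lra.
by rewrite pmulr_rge0 //; lra.
Qed.

(** * Comparison of the solution with its reflection *)

Section reflection.
Context {R : realType} {N : nat}.
Variables (f : R -> R -> R -> R) (u : 'rV[R]_N -> R -> R) (C L R0 A : R).
Hypothesis f_lip : forall t r a b : R, 0 < t -> 0 <= r -> `|a| <= C -> `|b| <= C ->
  b <= a -> f t r a - f t r b <= L * (a - b).
Hypothesis f_mono : forall t r1 r2 v : R, 0 < t ->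
  (0 <= r1 <= R0 /\ R0 <= r2) \/ (R0 <= r1 /\ r1 <= r2) ->
  f t r2 v <= f t r1 v.
Hypothesis u_C21 : C21 [set t | 0 < t] u.
Hypothesis u_cont : continuous_on_spacetime [set t | 0 <= t] u.
Hypothesis u_pde : forall x (t : R), 0 < t ->
  dt u x t - laplacian u x t = f t (enorm x) (u x t).
Hypothesis u_bound : forall x (t : R), 0 < t -> `|u x t| <= C.
Hypothesis u_init_ge0 : forall x, 0 <= u x 0.
Hypothesis u_init_supp : forall x, A <= enorm x -> u x 0 = 0.
Hypothesis L_ge0 : 0 <= L.
Hypothesis A_gt0 : 0 < A.
Hypothesis R0_le : R0 <= A.

(** If [W x t] were positive, [Z] would have a nonnegative maximum at a positive time and off the
    hyperplane; the derivative conditions there contradict the equation. *)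
Lemma u_le_refl (e : 'rV[R]_N) (lam : R) x (t : R) : dotv e e = 1 -> A <= lam ->
  0 < t -> lam <= dotv x e -> u x t <= u (refl e lam x) t.
Proof.
move=> e1 Al t0 xlam; rewrite leNgt -subr_gt0; apply/negP => W0.
pose W (y : 'rV[R]_N) (s : R) : R := u y s - u (refl e lam y) s.
pose K := L + 1.
pose q (y : 'rV[R]_N) (s : R) : R := dotv y y + (2 * N%:R * s + 1).
(* [expR (- K * s)] with [K > L] absorbs the zeroth-order term [L * W], and the
   barrier [q], a solution of the heat equation, forces a maximum over the
   unbounded half-space to be attained; [eps] is chosen so that [Z x t = 0]. *)
pose eps := expR (- K * t) * W x t / q x t.
have q_gt0 y (s : R) : 0 <= s -> 0 < q y s.
  by move=> s0; rewrite ltr_wpDl ?dotv_ge0 // ltr_wpDl // !mulr_ge0.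
have eps0 : 0 < eps by rewrite divr_gt0 ?q_gt0 ?mulr_gt0 ?expR_gt0 // ltW.
pose Z (y : 'rV[R]_N) (s : R) : R := expR (- K * s) * W y s - eps * q y s.
have Zx : Z x t = 0.
  by rewrite /Z /eps divfK ?subrr // gt_eqF // q_gt0 // ltW.
have C0 : 0 <= C by apply: le_trans (normr_ge0 _) (u_bound x t0).
have lam0 : 0 < lam by exact: lt_le_trans Al.
have far y : lam <= dotv y e -> A <= enorm y.
  by move=> ylam; apply: le_trans Al (le_trans ylam (dotv_unit_le _ e1)).
(* With this choice [2 * C = eps * (rho - 1)], so beyond radius [rho] the barrier exceeds the bound
   [2 * C] on [W]. *)
pose rho := 1 + 2 * C / eps.
(* On the half-space [u] vanishes initially, while its reflected value is nonnegative. *)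
have Zneg0 y : lam <= dotv y e -> Z y 0 < 0.
  move=> ylam; rewrite /Z /W u_init_supp ?far // sub0r mulrN subr_lt0.
  apply: (@le_lt_trans _ _ 0); last by rewrite mulr_gt0 // q_gt0.
  by rewrite oppr_le0 mulr_ge0 // ltW // expR_gt0.
have ZnegB y (s : R) : dotv y e = lam -> 0 <= s -> Z y s < 0.
  move=> ylam s0; rewrite /Z /W reflE // subrr mulr0 sub0r oppr_lt0.
  by rewrite mulr_gt0 // q_gt0.
have Zneg_far y (s : R) : lam <= dotv y e -> 0 <= s -> rho < `|y| -> Z y s < 0.
  move=> ylam; rewrite le_eqVlt => /predU1P[<- _|s0 yrho]; first exact: Zneg0.
  have Wle : W y s <= 2 * C.
    have := u_bound y s0; have := u_bound (refl e lam y) s0.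
    by rewrite !ler_norml /W => /andP[? ?] /andP[? ?]; lra.
  have E1 : expR (- K * s) <= 1.
    by rewrite -expR0 ler_expR mulNr oppr_le0 mulr_ge0 ?(ltW s0) // addr_ge0.
  have E0 : 0 < expR (- K * s) by exact: expR_gt0.
  have Zle : expR (- K * s) * W y s <= 2 * C.
    apply: le_trans (ler_wpM2l (ltW E0) Wle) _.
    by apply: ler_piMl; rewrite // mulr_ge0.
  rewrite /Z subr_lt0; apply: (le_lt_trans Zle).
  have yr : rho < enorm y by apply: (lt_le_trans yrho); exact: normr_le_enorm.
  have rho1 : 1 <= rho by rewrite lerDl divr_ge0 ?(ltW eps0) //; lra.
  have : 2 * C = eps * (rho - 1) by rewrite /rho; field; rewrite gt_eqF.
  move=> ->; rewrite ltr_pM2l // /q -enorm_sqr.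
  have : 0 <= 2 * N%:R * s by rewrite !mulr_ge0 // ltW.
  by nra.
have Ns : {within [set y : 'rV[R]_N | lam <= dotv y e /\ `|y| <= rho]
    `*` `[0, t]%classic, continuous (fun p : 'rV[R]_N * R => Z p.1 p.2)}.
  set S := _ `*` _.
  have ST p : S p -> 0 <= p.2 by move=> [_] /=; rewrite in_itv /= => /andP[].
  have cu1 : {within S, continuous (fun p => u p.1 p.2)}.
    by apply: continuous_subspaceW u_cont => p; exact: ST.
  have cu2 : {within S, continuous (fun p => u (refl e lam p.1) p.2)}.
    apply: (within_continuous_comp (f := fun p => (refl e lam p.1, p.2))
      (g := fun p => u p.1 p.2) _ _ u_cont) => // p.
    apply: (@cvg_pair _ _ _ (nbhs p) (nbhs (refl e lam p.1)) (nbhs p.2)).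
      by apply: (@continuous_comp _ _ _ fst (refl e lam));
        [exact: cvg_fst | exact: refl_continuous].
    exact: cvg_snd.
  have cE : continuous (fun p : 'rV[R]_N * R => expR (- K * p.2)).
    move=> p; apply: (@continuous_comp _ _ _ (fun p => - K * p.2) expR).
      by apply: continuousM; [exact: cst_continuous | exact: cvg_snd].
    exact: continuous_expR.
  have cq : continuous (fun p : 'rV[R]_N * R => eps * q p.1 p.2).
    move=> p; apply: (@continuousM _ _ (fun=> eps) (fun p => q p.1 p.2)).
      exact: cst_continuous.
    apply: (@cvgD _ _ _ (nbhs p) _ (fun p => dotv p.1 p.1)
        (fun p => 2 * N%:R * p.2 + 1)).
      apply: (@continuous_comp _ _ _ fst (fun y => dotv y y));
        [exact: cvg_fst | exact: dotv_sqr_continuous].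
    apply: (@cvgD _ _ _ (nbhs p) _ (fun p => 2 * N%:R * p.2) (fun=> 1));
      last exact: cvg_cst.
    by apply: (@cvgM _ _ (nbhs p)); [exact: cvg_cst | exact: cvg_snd].
  apply: (@within_continuousB _ _ _ S (fun p => expR (- K * p.2) * W p.1 p.2)).
    move=> p; apply: (@cvgM _ _ (nbhs p)); first exact: continuous_subspaceT cE p.
    by apply: cvgB; [exact: cu1 | exact: cu2].
  exact: continuous_subspaceT.
have xrho : `|x| <= rho.
  by rewrite leNgt; apply/negP => /(Zneg_far _ _ xlam (ltW t0)); rewrite Zx ltxx.
have [|[x0 s0]] := compact_EVT_max _ (@compact_slab R N e lam rho t) Ns.
  by exists (x, t); split => //=; rewrite in_itv /= (ltW t0) lexx.
rewrite inE => -[[/= x0lam x0rho]]; rewrite in_itv /= => /andP[s0_ge0 s0t] Zmax.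
(* The maximum over the truncated slab is one over the whole half-space: beyond [rho], [Z] is
   negative, hence below [Z x t = 0]. *)
have {}Zmax y (s : R) : lam <= dotv y e -> 0 <= s <= t -> Z y s <= Z x0 s0.
  move=> ylam st; have [yr|yr] := leP `|y| rho.
    by apply: (Zmax (y, s)); rewrite inE; split => //=; rewrite in_itv.
  have /andP[s_ge0 _] := st; apply: ltW (lt_le_trans (Zneg_far _ _ ylam s_ge0 yr) _).
  rewrite -Zx; apply: (Zmax (x, t)); rewrite inE; split => //=.
  by rewrite in_itv /= (ltW t0) lexx.
have Z0 : 0 <= Z x0 s0 by rewrite -Zx; apply: Zmax; rewrite // (ltW t0) lexx.
have s0_gt0 : 0 < s0.
  rewrite lt_neqAle s0_ge0 andbT; apply/eqP => E.
  by move: Z0; rewrite -E leNgt Zneg0.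
have {}x0lam : lam < dotv x0 e.
  rewrite lt_neqAle x0lam andbT eq_sym; apply/eqP => E.
  by move: Z0; rewrite leNgt ZnegB.
have W0' : 0 < W x0 s0.
  move: Z0; rewrite /Z subr_ge0 => H; rewrite -(pmulr_rgt0 _ (expR_gt0 (- K * s0))).
  by apply: lt_le_trans H; rewrite mulr_gt0 // q_gt0.
have [_ [dut _] [dux cux] [duxx cuxx]] := u_C21.
set y0 := refl e lam x0.
have dZt : 0 <= expR (- K * s0) * (dt u x0 s0 - dt u y0 s0 - K * W x0 s0)
    - eps * (2 * N%:R).
  suff dZ : is_derive s0 1 (Z x0) (expR (- K * s0) *
      (dt u x0 s0 - dt u y0 s0 - K * W x0 s0) - eps * (2 * N%:R)).
    apply: (derive_ge0_left_max s0_gt0 dZ) => s ss1 ss2.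
    by apply: Zmax; rewrite ?(ltW x0lam) // (ltW ss1) (le_trans ss2).
  have dW : is_derive s0 1 (W x0) (dt u x0 s0 - dt u y0 s0).
    by apply: is_deriveB; rewrite /dt derive1E; apply: derivableP; exact: dut.
  have -> : Z x0 = (fun s => expR (- K * s) * W x0 s) - eps *:
      ((2 * N%:R) *: (@id R) + cst (dotv x0 x0 + 1)).
    by apply/funext => s; rewrite /Z /q [X in eps * X]addrCA.
  apply: is_deriveB.
    by apply: (is_derive_eq (is_derive_expRM _ dW)); rewrite [- K * W _ _]mulNr.
  apply: is_deriveZ.
  by apply: is_derive_eq; rewrite addr0 -[_%:A]/(_ * 1) mulr1.
have dZx : expR (- K * s0) * (laplacian u x0 s0 - laplacian u y0 s0) <=
    N%:R * (2 * eps).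
  apply: (@laplacian_refl_at_max _ _ (u ^~ s0) e x0 lam _ eps (dotv x0 e - lam)).
  - by move=> i y; exact: dux.
  - by move=> i; exact: continuous_slice (cux i) s0_gt0.
  - by move=> i j y; exact: duxx.
  - by move=> i j; exact: continuous_slice (cuxx i j) s0_gt0.
  - by [].
  - by rewrite subr_gt0.
  - move=> i s sd.
    have : Z (s *: basis_vec i + x0) s0 <= Z x0 s0.
      apply: Zmax; last by rewrite s0_ge0.
      rewrite dotvDl dotvZl dotv_basis.
      (* As the coordinates of [e] are at most 1 in absolute value, a shift along an axis by less
         than [dotv x0 e - lam] stays in the half-space. *)
      have ei : `|e 0 i| <= 1.
        apply: le_trans (coord_le_enorm _ _) _.
        by rewrite -(ler_sqr (enorm_ge0 e) ler01) enorm_sqr e1 expr1n.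
      have : `|s * e 0 i| < dotv x0 e - lam.
        by apply: le_lt_trans sd; rewrite normrM ler_piMr.
      by rewrite ltr_norml => /andP[+ _]; lra.
    by rewrite /Z /q /W => H; lra.
(* Monotonicity in the radius compares [x0] with the nearer point [y0], on whichever side of [R0]
   the latter lies; the Lipschitz bound then changes the value of [u]. *)
have HL : f s0 (enorm x0) (u x0 s0) - f s0 (enorm y0) (u y0 s0) <= L * W x0 s0.
  have H1 : f s0 (enorm x0) (u x0 s0) <= f s0 (enorm y0) (u x0 s0).
    apply: f_mono => //; have R0x : R0 <= enorm x0.
      by apply: (le_trans R0_le); apply: far; exact: ltW.
    have [yR|yR] := leP (enorm y0) R0.
      by left; rewrite enorm_ge0.
    by right; split; [exact: ltW | apply: enorm_refl_le; rewrite // ltW].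
  apply: le_trans (f_lip s0_gt0 (enorm_ge0 y0) (u_bound _ s0_gt0)
    (u_bound _ s0_gt0) _); first by rewrite lerD2r.
  by rewrite -subr_ge0 ltW.
rewrite -!u_pde // in HL.
exact: strict_max_contradiction (expR_gt0 _) W0' dZt dZx HL.
Qed.

End reflection.

(** * Boxes and Lebesgue norms *)

Definition box {R : realType} {n : nat} (a : 'I_n -> R) (s : R) :
    set (n.-tuple (measurableTypeR R)) :=
  [set v | forall i, a i <= tnth v i <= a i + s].

Section box_measure.
Import HBNNSimple.
Context {R : realType}.
Local Open Scope ereal_scope.

Lemma measurable_box n (a : 'I_n -> R) s : measurable (box a s).
Proof.
have -> : box a s = \bigcap_(i in [set: 'I_n])
    ((fun v : n.-tuple (measurableTypeR R) => tnth v i) @^-1`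
      `[a i, (a i + s)%R]%classic).
  apply/seteqP; split => v /= H i; first by move=> _ /=; rewrite in_itv; exact: H.
  by have := H i I; rewrite /= in_itv.
apply: fin_bigcap_measurable => // i _.
by rewrite -[X in measurable X]setTI; apply: measurable_tnth.
Qed.

Lemma lebesgue_tuple_box n (a : 'I_n -> R) s : (0 <= s)%R ->
  lebesgue_tuple R n (box a s) = (s ^+ n)%:E.
Proof.
move=> s0; elim: n a => [|n IH] a.
  by rewrite /= diracE expr0 mem_set // => -[].
rewrite /= /lebesgue_cons /pushforward.
have -> : @tuple_cons R n @^-1` box a s =
    `[a ord0, (a ord0 + s)%R]%classic `*` box (a \o lift ord0) s.
  apply/seteqP; split => -[h v] /=.
    move=> H; split; first by rewrite /= in_itv; have := H ord0; rewrite tnth0.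
    by move=> i; have := H (lift ord0 i); rewrite tnthS.
  move=> [/= hI vB] i; case: (unliftP ord0 i) => [j|] ->.
    by rewrite tnthS; exact: vB.
  by rewrite tnth0; move: hI; rewrite in_itv.
rewrite product_measure1E //; last exact: measurable_box.
rewrite IH exprS EFinM; congr (_ * _).
have := @lebesgue_measure_itv R `[a ord0, (a ord0 + s)%R]; rewrite /= lte_fin => ->.
(* The interval formula yields 0 unless the endpoints are strictly ordered, so [s = 0] is a separate
   case. *)
have [s0'|s0'] := ltP; first by rewrite -EFinB addrC addKr.
have -> // : s = 0%R; by apply/eqP; rewrite eq_le s0 andbT; move: s0'; lra.
Qed.

(** By continuity, a value above [C] persists on a small cube, which has positive measure and so is
    seen by the essential supremum. *)
Lemma le_Lnorm_pinfty n (g : 'rV[R]_n -> R) (C : R) y : continuous g ->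
  Lq_norm +oo g <= C%:E -> (`|g y| <= C)%R.
Proof.
move=> cg gC; rewrite leNgt; apply/negP => Cg.
have cng : continuous (fun z => `|g z|%R).
  move=> z; apply: (@continuous_comp _ _ _ g Num.norm); first exact: cg.
  exact: norm_continuous.
have /nbhs_ballP[r /= r0 Hr] : nbhs y [set z | C < `|g z|]%R.
  exact: (@cvgr_gt _ _ _ _ _ _ (cng y) _ Cg).
pose B := box (fun i => y ord0 i) (r / 2).
have mB : measurable B by exact: measurable_box.
have Bg v : B v -> (C < `|g (row_of_tuple v)|)%R.
  move=> Bv; apply: Hr; rewrite -ball_normE /= [ltLHS]/Num.norm /= mx_normrE.
  apply: bigmax_lt => // -[i j] _ /=; rewrite ord1 !mxE.
  by have /= /andP[? ?] := Bv j; rewrite ltr_norml; apply/andP; split; lra.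
have muB : lebesgue_tuple R n B = ((r / 2) ^+ n)%:E.
  by apply: lebesgue_tuple_box; rewrite divr_ge0 // ltW.
have muB0 : 0 < lebesgue_tuple R n B.
  by rewrite muB lte_fin exprn_gt0 // divr_gt0.
(* The norm of exponent [+oo] is the essential supremum only when the whole space has positive
   measure. *)
move: gC; rewrite /Lq_norm unlock ifT; last first.
  by apply: lt_le_trans muB0 _; apply: le_measure; rewrite ?inE.
move=> /ess_supP /= [E [mE E0 HE]].
have : lebesgue_tuple R n B <= lebesgue_tuple R n E.
  apply: le_measure; rewrite ?inE // => v /Bg Cv.
  by apply: HE => /=; rewrite lee_fin leNgt Cv.
by rewrite E0 leNgt muB0.
Qed.

(** Markov's inequality on a cube, for the [q]-th power of the norm. *)
Lemma box_le_Lnorm n (g : 'rV[R]_n -> R) (a : 'I_n -> R) (C q eps s : R) :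
  (1 <= q)%R -> (0 <= eps)%R -> (0 <= s)%R ->
  (forall v, box a s v -> eps <= `|g (row_of_tuple v)|)%R ->
  Lq_norm q%:E g <= C%:E -> (eps `^ q * s ^+ n <= C `^ q)%R.
Proof.
move=> q1 eps0 s0 Hg gC.
have q0 : (0 < q)%R by lra.
have mB := measurable_box a s.
have C0 : 0 <= C%:E by apply: le_trans gC; exact: Lnorm_ge0.
have : \int[lebesgue_tuple R n]_v (`|(g (row_of_tuple v))%:E| `^ q) <= C%:E `^ q.
  rewrite -(poweR_Lnorm _ _ (lt0r_neq0 q0)).
  apply: gt0_ler_poweR; rewrite ?(ltW q0) // in_itv /= leey ?andbT //.
  exact: Lnorm_ge0.
rewrite poweR_EFin -lee_fin; apply: le_trans.
rewrite EFinM -(lebesgue_tuple_box a s0).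
(* The integral of a nonnegative function is a supremum over the simple functions
   below it, so a single one of them suffices and [g] need not be measurable. *)
rewrite ge0_integralTE; last by move=> v; exact: poweR_ge0.
apply: ereal_sup_ubound.
exists (scale_nnsfun (indic_nnsfun R mB) (powR_ge0 eps q)).
  move=> v /=; rewrite lee_fin measurable_realfun.mindicE.
  have [/set_mem Bv|_] := boolP (v \in _); last by rewrite mulr0 powR_ge0.
  by rewrite mulr1 ge0_ler_powR ?nnegrE ?(ltW q0) //; exact: Hg.
by rewrite -sintegral_indic -(sintegralrM _ _ (indic_nnsfun R mB)).
Qed.

End box_measure.

(** * Decay at infinity *)

Section decay.
Context {R : realType} {N : nat}.
Variables (u : 'rV[R]_N -> R -> R) (C q A : R).
Hypothesis N_gt0 : (0 < N)%N.
Hypothesis q_ge1 : 1 <= q.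
Hypothesis A_gt0 : 0 < A.
Hypothesis u_Lq : forall t, 0 < t -> (Lq_norm q%:E (u ^~ t) <= C%:E)%E.
Hypothesis u_radial : forall x y t, 0 < t -> enorm y + 2 * A <= enorm x ->
  u x t <= u y t.

Lemma uniform_decay (eps : R) : 0 < eps ->
  exists M, forall x t, M < enorm x -> 0 < t -> `|u x t| <= eps.
Proof.
move=> eps0.
have e0 : 0 < eps `^ q by exact: powR_gt0.
(* Chosen so that [s ^+ N >= s] and eps^q s = eps^q + C^q exceeds C^q, which rules out a cube of
   side [s] where |u| is at least [eps]. *)
pose s : R := 1 + C `^ q / eps `^ q.
have Cq0 : 0 <= C `^ q / eps `^ q by rewrite divr_ge0 // powR_ge0.
have s1 : 1 <= s by rewrite lerDl.
have s0 : 0 <= s by lra.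
have small t (a : 'I_N -> R) : 0 < t ->
    ~ (forall v, box a s v -> eps <= `|u (row_of_tuple v) t|).
  move=> t0 H; have := box_le_Lnorm q_ge1 (ltW eps0) s0 H (u_Lq t0).
  apply/negP; rewrite -ltNge; apply: (@lt_le_trans _ _ (eps `^ q * s)).
    rewrite /s mulrDr mulr1 mulrCA divff ?mulr1 ?gt_eqF //; lra.
  by rewrite ler_pM2l // -[leLHS]expr1 ler_weXn2l.
exists (N%:R * s + 2 * A) => x t xM t0.
rewrite leNgt ltr_normr; apply/negP => /orP[ux|ux].
  (* The cube [0, s]^N lies in the ball of radius [N%:R * s], hence at least 2A closer to the origin
     than [x]. *)
  apply: (small t (fun=> 0)) => // v vB; apply: le_trans (ler_norm _).
  apply: le_trans (ltW ux) _; apply: u_radial => //.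
  apply: le_trans (ltW xM); rewrite lerD2r; apply: enorm_le_sum => // i.
  by have := vB i; rewrite mxE add0r => /andP[v0 vs]; rewrite ger0_norm.
(* Every point of this cube has first coordinate, hence norm, at least |x| + 2A. *)
apply: (small t (fun=> enorm x + 2 * A)) => // v vB.
rewrite -normrN; apply: le_trans (ler_norm _).
apply: le_trans (ltW ux) _; rewrite lerN2; apply: u_radial => //.
have /andP[vx _] := vB (Ordinal N_gt0).
apply: le_trans vx (le_trans (ler_norm _) _).
by have := coord_le_enorm (row_of_tuple v) (Ordinal N_gt0); rewrite mxE.
Qed.

Lemma cvg_sup_at_infinity :
  ereal_sup [set (`|u x t|)%:E | t in [set t : R | 0 < t]] @[x --> at_infinity R N]
    --> (0 : \bar R).
Proof.
pose S (x : 'rV[R]_N) : \bar R :=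
  ereal_sup [set (`|u x t|)%:E | t in [set t : R | 0 < t]].
change (S x @[x --> at_infinity R N] --> (0 : \bar R)).
have S0 x : (0 <= S x)%E.
  apply: (@le_trans _ _ (`|u x 1|)%:E); first by rewrite lee_fin.
  by apply: ereal_sup_ubound; exists 1 => /=.
have Sle eps : 0 < eps -> \forall x \near at_infinity R N, (S x <= eps%:E)%E.
  move=> /uniform_decay[M HM]; exists M => // x /= Mx.
  by apply: ge_ereal_sup => _ [t /= t0 <-]; rewrite lee_fin HM.
apply/fine_cvgP; split.
  apply: filterS (Sle 1 ltr01) => x Sx.
  by rewrite ge0_fin_numE //; exact: le_lt_trans Sx (ltry _).
apply/cvgrPdist_le => eps eps0; apply: filterS (Sle eps eps0) => x Sx.
rewrite sub0r normrN /= -/(S x) ger0_norm ?fine_ge0 //.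
by rewrite -lee_fin fineK // ge0_fin_numE //; exact: le_lt_trans Sx (ltry _).
Qed.

End decay.

(** * Support of the initial datum and proof of the theorem *)

Lemma compact_support_enorm (R : realType) (N : nat) (g : 'rV[R]_N -> R) :
  compact_support g -> exists M, forall x, M < enorm x -> g x = 0.
Proof.
move=> /compact_bounded [M [_ HM]]; exists (N%:R * (`|M| + 1)) => x.
apply: contraTeq => gx; rewrite -leNgt.
have xM : `|x| <= `|M| + 1.
  apply: HM; last by exact: subset_closure.
  by have := ler_norm M; lra.
apply: enorm_le_sum => [|i]; first by rewrite addr_ge0.
exact: le_trans (coord_le_normr _ _) xM.
Qed.

Theorem lemma1p9 (R : realType) (N : nat) (hN : (2 <= N)%N)
  (f : R -> R -> R -> R) (R0 : R) (u : 'rV[R]_N -> R -> R) (u0 : 'rV[R]_N -> R)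
  (C q : R)
  (hf_du : du_bounded_uniformly f)
  (hR0 : 0 < R0)
  (hf_mono : forall t r1 r2 v : R, 0 < t ->
     (0 <= r1 <= R0 /\ R0 <= r2) \/ (R0 <= r1 /\ r1 <= r2) ->
     f t r2 v <= f t r1 v)
  (hu_C21 : C21 [set t | 0 < t] u)
  (hu_cont : continuous_on_spacetime [set t | 0 <= t] u)
  (hu_pde : forall x t, 0 < t -> dt u x t - laplacian u x t = f t (enorm x) (u x t))
  (hu_init : forall x, u x 0 = u0 x)
  (hu0_ge0 : forall x, 0 <= u0 x)
  (hu0_supp : compact_support u0)
  (hC : 0 < C) (hq : 1 <= q)
  (hu_Linfty : forall t, 0 < t -> (Lq_norm +oo (u ^~ t) <= C%:E)%E)
  (hu_Lq : forall t, 0 < t -> (Lq_norm q%:E (u ^~ t) <= C%:E)%E) :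
  ereal_sup [set (`|u x t|)%:E | t in [set t : R | 0 < t]] @[x --> at_infinity R N]
    --> (0 : \bar R).
Proof.
have [duf [L0 duL]] : (forall t r v, 0 <= t -> 0 <= r -> derivable (f t r) v 1) /\
    exists L, forall t r v, 0 <= t -> 0 <= r -> `|v| <= C ->
      `|derive1 (f t r) v| <= L.
  by case: hf_du => duf /(_ C).
have [M0 u0M] := compact_support_enorm hu0_supp.
have cu : continuous_on_spacetime [set t | 0 < t] u by case: hu_C21.
have u_bound x t : 0 < t -> `|u x t| <= C.
  move=> t0; apply: (@le_Lnorm_pinfty _ _ (u ^~ t) C x _ (hu_Linfty t t0)).
  exact: continuous_slice cu t0.
(* The summand 1 turns [A <= enorm x] into the strict inequality that [u0M] requires. *)
pose A := Num.max R0 (M0 + 1).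
have R0A : R0 <= A by rewrite le_max lexx.
have A0 : 0 < A := lt_le_trans hR0 R0A.
have f_lip t r a b : 0 < t -> 0 <= r -> `|a| <= C -> `|b| <= C -> b <= a ->
    f t r a - f t r b <= `|L0| * (a - b).
  move=> t0 r0; apply: derive_le_lipschitz => v; first exact: duf (ltW t0) r0.
  by move=> vC; apply: le_trans (ler_norm _); exact: duL (ltW t0) r0 vC.
have u_init_ge0 x : 0 <= u x 0 by rewrite hu_init.
have u_init_supp x : A <= enorm x -> u x 0 = 0.
  rewrite ge_max => /andP[_ xM]; rewrite hu_init; apply: u0M; lra.
apply: (@cvg_sup_at_infinity R N u C q A) => //; first exact: ltnW.
move=> x y t t0 /(refl_bisector A0)[e [lam [e1 Alam lamx <-]]].
exact: (u_le_refl f_lip hf_mono hu_C21 hu_cont hu_pde u_bound u_init_ge0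
  u_init_supp (normr_ge0 L0) A0 R0A).
Qed.
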